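(* Let $c\ge1$ and let $\mathfrak n$ be a $c$-$\mathsf{Lie}$-central two-sided ideal of a Leibniz algebra $\mathfrak q$. Then the following statements are equivalent: (a) $\mathfrak n\cap\gamma_{c+1}^{\mathsf{Lie}}(\mathfrak q)\cong\dfrac{\mathcal M_{\mathsf{Lie}}^{(c)}(\mathfrak q/\mathfrak n)}{\mathcal M_{\mathsf{Lie}}^{(c)}(\mathfrak q)}$. (b) $\mathfrak n\subseteq\mathsf{Z}^{\ast}(\mathfrak q)$. (c) The natural map $\mathcal M_{\mathsf{Lie}}^{(c)}(\mathfrak q)\to\mathcal M_{\mathsf{Lie}}^{(c)}(\mathfrak q/\mathfrak n)$ is injective.
   Context: $\mathbb K$ is a field with $\frac12\in\mathbb K$. A Leibniz algebra is a $\mathbb K$-vector space with a bilinear bracket satisfying $[x,[y,z]]=[[x,y],z]-[[x,z],y]$. For two-sided ideals $\mathfrak m,\mathfrak n$ of $\mathfrak q$, $[\mathfrak m,\mathfrak n]_{\mathsf{Lie}}$ is the span of all $[m,n]+[n,m]$, $m\in\mathfrak m$, $n\in\mathfrak n$. For a two-sided ideal $\mathfrak n$: $\gamma_1^{\mathsf{Lie}}(\mathfrak q,\mathfrak n)=\mathfrak n$, $\gamma_i^{\mathsf{Lie}}(\mathfrak q,\mathfrak n)=[\gamma_{i-1}^{\mathsf{Lie}}(\mathfrak q,\mathfrak n),\mathfrak q]_{\mathsf{Lie}}$ for $i\ge2$, and $\gamma_i^{\mathsf{Lie}}(\mathfrak q)=\gamma_i^{\mathsf{Lie}}(\mathfrak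 q,\mathfrak q)$. $\mathfrak n$ is $c$-$\mathsf{Lie}$-central if $\gamma_{c+1}^{\mathsf{Lie}}(\mathfrak q,\mathfrak n)=0$. $\mathcal Z_0^{\mathsf{Lie}}(\mathfrak h)=0$, $\mathcal Z_i^{\mathsf{Lie}}(\mathfrak h)=\{x\in\mathfrak h:[x,h]+[h,x]\in\mathcal Z_{i-1}^{\mathsf{Lie}}(\mathfrak h)\ \forall h\in\mathfrak h\}$. A Leibniz algebra is $c$-$\mathsf{Lie}$-capable if it is isomorphic to $\mathfrak h/\mathcal Z_c^{\mathsf{Lie}}(\mathfrak h)$ for some Leibniz algebra $\mathfrak h$; $\mathsf{Z}^{\ast}(\mathfrak q)$ is the smallest two-sided ideal $\mathfrak s$ of $\mathfrak q$ with $\mathfrak q/\mathfrak s$ $c$-$\mathsf{Lie}$-capable. Given a free presentation $0\to\mathfrak r\to\mathfrak f\xrightarrow{\rho}\mathfrak q\to0$ ($\mathfrak f$ a free Leibniz algebra) and $\mathfrak s=\rho^{-1}(\mathfrak n)$, $\mathcal M_{\mathsf{Lie}}^{(c)}(\mathfrak q)=(\mathfrak r\cap\gamma_{c+1}^{\mathsf{Lie}}(\mathfrak f))/\gamma_{c+1}^{\mathsf{Lie}}(\mathfrak f,\mathfrak r)$, $\mathcal M_{\mathsf{Lie}}^{(c)}(\mathfrak q/\mathfrak n)=(\mathfrak s\cap\gamma_{c+1}^{\mathsf{Lie}}(\mathfrak f))/\gamma_{c+1}^{\mathsf{Lie}}(\mathfrak f,\mathfrak s)$, and the natural map is induced by $\mathfrak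 r\subseteq\mathfrak s$. In (a), the quotient means that $\mathcal M_{\mathsf{Lie}}^{(c)}(\mathfrak q)$ is embedded in $\mathcal M_{\mathsf{Lie}}^{(c)}(\mathfrak q/\mathfrak n)$ by the natural map, and the isomorphism is the one induced by $\rho$. *)

(* Defs.v *)
From HB Require Import structures.
From mathcomp Require Import all_boot all_order all_algebra.
From mathcomp Require Import boolp classical_sets.

Set Implicit Arguments.
Unset Strict Implicit.
Unset Printing Implicit Defensive.

Import GRing.Theory.
Local Open Scope ring_scope.
Local Open Scope quotient_scope.
Local Open Scope classical_set_scope.

HB.mixin Record Lmodule_isLeibniz (K : fieldType) L of GRing.Lmodule K L := {
  bracket : L -> L -> L;
  bracket_linearr : forall x, linear (bracket x);
  bracket_linearl : forall y, linear (bracket^~ y);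
  leibniz_identity : forall x y z, bracket x (bracket y z) =
    bracket (bracket x y) z - bracket (bracket x z) y
}.

#[short(type="leibnizType")]
HB.structure Definition Leibniz (K : fieldType) :=
  {L of Lmodule_isLeibniz K L & GRing.Lmodule K L}.

HB.mixin Record isLeibnizMorphism (K : fieldType) (L M : leibnizType K)
    (f : L -> M) := {
  bracket_morph : {morph f : x y / bracket x y}
}.

HB.structure Definition LeibnizMorphism (K : fieldType) (L M : leibnizType K) :=
  {f of isLeibnizMorphism K L M f & @GRing.Linear K L M *:%R f}.

Notation "{ 'leibniz' L -> M }" := (LeibnizMorphism.type L M)
  (at level 0, L at level 98, M at level 99,
   format "{ 'leibniz'  L  ->  M }") : type_scope.

Definition leibniz_isomorphic (K : fieldType) (L M : leibnizType K) : Prop :=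
  exists f : {leibniz L -> M}, bijective f.

Section BracketTheory.
Variables (K : fieldType) (L : leibnizType K).
Implicit Types x y z : L.

Lemma bracketDr x y z : bracket x (y + z) = bracket x y + bracket x z.
Proof. by have := bracket_linearr x 1 y z; rewrite !scale1r. Qed.
Lemma bracketDl x y z : bracket (y + z) x = bracket y x + bracket z x.
Proof. by have := bracket_linearl x 1 y z; rewrite !scale1r. Qed.
Lemma bracket0r x : bracket x 0 = 0.
Proof. by apply: (addIr (bracket x 0)); rewrite -bracketDr !add0r. Qed.
Lemma bracket0l x : bracket 0 x = 0.
Proof. by apply: (addIr (bracket 0 x)); rewrite -bracketDl !add0r. Qed.
Lemma bracketZr a x y : bracket x (a *: y) = a *: bracket x y.
Proof. by have := bracket_linearr x a y 0; rewrite bracket0r !addr0. Qed.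
Lemma bracketZl a x y : bracket (a *: y) x = a *: bracket y x.
Proof. by have := bracket_linearl x a y 0; rewrite bracket0l !addr0. Qed.
Lemma bracketNr x y : bracket x (- y) = - bracket x y.
Proof. by rewrite -scaleN1r bracketZr scaleN1r. Qed.
Lemma bracketNl x y : bracket (- y) x = - bracket y x.
Proof. by rewrite -scaleN1r bracketZl scaleN1r. Qed.

Definition lie_sym x y := bracket x y + bracket y x.

Lemma lie_symDl x y z : lie_sym (x + y) z = lie_sym x z + lie_sym y z.
Proof. by rewrite /lie_sym bracketDl bracketDr addrACA. Qed.
Lemma lie_symZl a x z : lie_sym (a *: x) z = a *: lie_sym x z.
Proof. by rewrite /lie_sym bracketZl bracketZr scalerDr. Qed.
Lemma lie_sym0l z : lie_sym 0 z = 0.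
Proof. by rewrite /lie_sym bracket0l bracket0r addr0. Qed.

Lemma bracket_sym0 x y z : bracket x (lie_sym y z) = 0.
Proof.
by rewrite bracketDr !leibniz_identity addrA subrK subrr.
Qed.

Lemma bracket_swap x y z : bracket x (bracket y z) = - bracket x (bracket z y).
Proof. by apply/eqP; rewrite -addr_eq0 -bracketDr bracket_sym0. Qed.

Lemma bracket_derivation x y z :
  bracket (bracket x y) z = bracket (bracket x z) y + bracket x (bracket y z).
Proof. by rewrite leibniz_identity addrC subrK. Qed.

Lemma lie_sym_derivation x y z :
  bracket (lie_sym x y) z = lie_sym (bracket x z) y + lie_sym x (bracket y z).
Proof.
rewrite /lie_sym bracketDl [bracket (bracket x y) z]bracket_derivation.
by rewrite [bracket (bracket y x) z]bracket_derivation
           [in LHS](addrC (bracket (bracket y z) x)) addrACA.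
Qed.

End BracketTheory.

Record ideal (K : fieldType) (L : leibnizType K) := Ideal {
  ideal_set :> L -> Prop;
  ideal0 : ideal_set 0;
  ideal_lin : forall a x y,
    ideal_set x -> ideal_set y -> ideal_set (a *: x + y);
  ideal_bracketl : forall x y, ideal_set x -> ideal_set (bracket x y);
  ideal_bracketr : forall x y, ideal_set x -> ideal_set (bracket y x)
}.

Section Ideals.
Variables (K : fieldType) (L : leibnizType K).
Implicit Types I J m n : ideal L.

Lemma idealD I x y : I x -> I y -> I (x + y).
Proof. by move=> Ix Iy; rewrite -[x]scale1r; apply: ideal_lin. Qed.
Lemma idealZ I a x : I x -> I (a *: x).
Proof. by move=> Ix; rewrite -[_ *: _]addr0; apply/ideal_lin/ideal0. Qed.
Lemma idealN I x : I x -> I (- x).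
Proof. by move=> Ix; rewrite -scaleN1r; apply: idealZ. Qed.
Lemma idealB I x y : I x -> I y -> I (x - y).
Proof. by move=> Ix Iy; apply/idealD/idealN. Qed.
Lemma ideal_sum I (T : eqType) (s : seq T) (F : T -> L) :
  (forall i, i \in s -> I (F i)) -> I (\sum_(i <- s) F i).
Proof.
move=> IF; rewrite big_seq; elim/big_rec: _ => [|i x /IF Ii Ix].
  exact: ideal0.
exact: idealD.
Qed.

Fact zero_ideal0 : [set (0 : L)] 0. Proof. by []. Qed.
Fact zero_ideal_lin a x y :
  [set (0 : L)] x -> [set (0 : L)] y -> [set (0 : L)] (a *: x + y).
Proof. by move=> -> ->; rewrite scaler0 addr0. Qed.
Fact zero_ideal_bracketl x y : [set (0 : L)] x -> [set (0 : L)] (bracket x y).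
Proof. by move=> ->; exact: bracket0l. Qed.
Fact zero_ideal_bracketr x y : [set (0 : L)] x -> [set (0 : L)] (bracket y x).
Proof. by move=> ->; exact: bracket0r. Qed.
Definition zero_ideal : ideal L :=
  Ideal zero_ideal0 zero_ideal_lin zero_ideal_bracketl zero_ideal_bracketr.

Definition full_ideal : ideal L :=
  @Ideal K L setT Logic.I (fun _ _ _ _ _ => Logic.I)
    (fun _ _ _ => Logic.I) (fun _ _ _ => Logic.I).

Section Intersection.
Variables I J : ideal L.
Fact capI0 : (I `&` J) 0. Proof. by split; exact: ideal0. Qed.
Fact capI_lin a x y : (I `&` J) x -> (I `&` J) y -> (I `&` J) (a *: x + y).
Proof. by move=> [? ?] [? ?]; split; exact: ideal_lin. Qed.
Fact capI_bracketl x y : (I `&` J) x -> (I `&` J) (bracket x y).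
Proof. by move=> [? ?]; split; exact: ideal_bracketl. Qed.
Fact capI_bracketr x y : (I `&` J) x -> (I `&` J) (bracket y x).
Proof. by move=> [? ?]; split; exact: ideal_bracketr. Qed.
Definition cap_ideal : ideal L :=
  Ideal capI0 capI_lin capI_bracketl capI_bracketr.
End Intersection.

Definition lspan (A : set L) : set L :=
  [set x | exists s : seq (K * L),
     (forall p, p \in s -> A p.2) /\ x = \sum_(p <- s) p.1 *: p.2].

Lemma sub_lspan A : A `<=` lspan A.
Proof.
move=> x Ax; exists [:: (1, x)]; split=> [p|].
  by rewrite inE => /eqP ->.
by rewrite big_seq1 scale1r.
Qed.

Lemma lspan0 A : lspan A 0.
Proof. by exists [::]; split=> //; rewrite big_nil. Qed.

Lemma lspan_lin A a x y : lspan A x -> lspan A y -> lspan A (a *: x + y).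
Proof.
move=> [s [sA ->]] [t [tA ->]].
exists ([seq (a * p.1, p.2) | p <- s] ++ t); split=> [p|].
  by rewrite mem_cat => /orP[/mapP[p' /sA ? ->]|/tA].
rewrite big_cat big_map scaler_sumr; congr (_ + _).
by apply: eq_bigr => p _; rewrite scalerA.
Qed.

Lemma lspan_min A (B : set L) : B 0 ->
  (forall a x y, B x -> B y -> B (a *: x + y)) -> A `<=` B -> lspan A `<=` B.
Proof.
move=> B0 Blin AB x [s [sA ->]].
elim: s sA => [|p s IHs] sA; first by rewrite big_nil.
rewrite big_cons; apply: Blin; first by apply/AB/sA; rewrite mem_head.
by apply: IHs => p' p's; apply: sA; rewrite inE p's orbT.
Qed.

Lemma lspan_sub A (B : set L) : A `<=` B -> lspan A `<=` lspan B.
Proof.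
move=> AB x [s [sA ->]]; exists s; split=> // p ps; exact/AB/sA.
Qed.

(** [m, n]_Lie; no ideal closure is taken, as the span is already an ideal. *)
Section LieCommutator.
Variables m n : ideal L.

Definition lie_comm_gens : set L :=
  [set z | exists x y, [/\ m x, n y & z = lie_sym x y]].

Fact lie_comm_bracketl x y :
  lspan lie_comm_gens x -> lspan lie_comm_gens (bracket x y).
Proof.
apply: (lspan_min (B := fun x => lspan lie_comm_gens (bracket x y))).
- by rewrite bracket0l; exact: lspan0.
- by move=> a u v ? ?; rewrite bracket_linearl; exact: lspan_lin.
move=> _ [u [v [mu nv ->]]]; rewrite lie_sym_derivation -[lie_sym (bracket _ _) _]scale1r.
apply: lspan_lin; apply: sub_lspan.
  by exists (bracket u y), v; split=> //; exact: ideal_bracketl.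
by exists u, (bracket v y); split=> //; exact: ideal_bracketl.
Qed.

Fact lie_comm_bracketr x y :
  lspan lie_comm_gens x -> lspan lie_comm_gens (bracket y x).
Proof.
apply: (lspan_min (B := fun x => lspan lie_comm_gens (bracket y x))).
- by rewrite bracket0r; exact: lspan0.
- by move=> a u v ? ?; rewrite bracket_linearr; exact: lspan_lin.
by move=> _ [u [v [_ _ ->]]]; rewrite bracket_sym0; exact: lspan0.
Qed.

Definition lie_comm : ideal L :=
  Ideal (lspan0 _) (@lspan_lin _) lie_comm_bracketl lie_comm_bracketr.

End LieCommutator.

(** The relative lower Lie-central series, indexed from 1 as in
    gamma_1(L, n) = n and gamma_i(L, n) = [gamma_(i-1)(L, n), L]_Lie;
    the value at index 0 is junk (equal to the value at index 1). *)
Definition gamma_lie (i : nat) n : ideal L :=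
  iter i.-1 (fun m => lie_comm m full_ideal) n.

Definition lie_central (c : nat) n : Prop :=
  gamma_lie c.+1 n = [set 0] :> set L.

Lemma lie_comm_sub m m' n : m `<=` m' -> lie_comm m n `<=` lie_comm m' n.
Proof.
move=> mm'; apply: lspan_sub => _ [u [v [mu nv ->]]].
by exists u, v; split=> //; exact: mm'.
Qed.

Lemma gamma_lie_sub i m n : m `<=` n -> gamma_lie i m `<=` gamma_lie i n.
Proof.
by move=> mn; rewrite /gamma_lie; elim: i.-1 => //= k IHk; exact: lie_comm_sub.
Qed.

(** The preimage in [L] of the Lie-centre of [L / I]. *)
Section LieCentreMod.
Variable I : ideal L.

Definition lie_centre_set : set L := [set x | forall h, I (lie_sym x h)].

Fact lie_centre0 : lie_centre_set 0.
Proof. by move=> h; rewrite lie_sym0l; exact: ideal0. Qed.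
Fact lie_centre_lin a x y :
  lie_centre_set x -> lie_centre_set y -> lie_centre_set (a *: x + y).
Proof.
by move=> Ix Iy h; rewrite lie_symDl lie_symZl; exact: ideal_lin.
Qed.
Fact lie_centre_bracketl x y :
  lie_centre_set x -> lie_centre_set (bracket x y).
Proof.
move=> Ix h.
have -> : lie_sym (bracket x y) h =
    bracket (lie_sym x h) y - lie_sym x (bracket h y).
  by rewrite lie_sym_derivation addrK.
by apply: idealB; [apply/ideal_bracketl/Ix | exact: Ix].
Qed.
Fact lie_centre_bracketr x y :
  lie_centre_set x -> lie_centre_set (bracket y x).
Proof.
move=> Ix h.
have -> : lie_sym (bracket y x) h =
    lie_sym (lie_sym x y) h - lie_sym (bracket x y) h.
  by rewrite [lie_sym x y]addrC lie_symDl addrK.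
apply: idealB; last exact: lie_centre_bracketl.
by apply: idealD; [apply/ideal_bracketl/Ix | apply/ideal_bracketr/Ix].
Qed.
Definition lie_centre_mod : ideal L :=
  Ideal lie_centre0 lie_centre_lin lie_centre_bracketl lie_centre_bracketr.

End LieCentreMod.

Definition lie_centre (i : nat) : ideal L := iter i lie_centre_mod zero_ideal.

End Ideals.

Arguments zero_ideal {K L}.
Arguments full_ideal {K L}.
Arguments lie_centre {K} L i.

Section Preimage.
Variables (K : fieldType) (L M : leibnizType K) (f : {leibniz L -> M}).
Variable I : ideal M.
Fact preim_ideal0 : (f @^-1` I) 0.
Proof. by rewrite /preimage /= raddf0; exact: ideal0. Qed.
Fact preim_ideal_lin a x y :
  (f @^-1` I) x -> (f @^-1` I) y -> (f @^-1` I) (a *: x + y).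
Proof. by move=> Ix Iy; rewrite /preimage /= linearP; exact: ideal_lin. Qed.
Fact preim_ideal_bracketl x y : (f @^-1` I) x -> (f @^-1` I) (bracket x y).
Proof. by move=> Ix; rewrite /preimage /= bracket_morph; exact: ideal_bracketl. Qed.
Fact preim_ideal_bracketr x y : (f @^-1` I) x -> (f @^-1` I) (bracket y x).
Proof. by move=> Ix; rewrite /preimage /= bracket_morph; exact: ideal_bracketr. Qed.
Definition preim_ideal : ideal L := Ideal preim_ideal0 preim_ideal_lin
  preim_ideal_bracketl preim_ideal_bracketr.
End Preimage.

Definition ker_ideal (K : fieldType) (L M : leibnizType K)
  (f : {leibniz L -> M}) : ideal L := preim_ideal f zero_ideal.

Definition ideal_pred (K : fieldType) (L : leibnizType K) (I : ideal L) :
  {pred L} := fun x => `[< I x >].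

Section Subalgebra.
Variables (K : fieldType) (L : leibnizType K) (I : ideal L).

Lemma ideal_predP x : reflect (I x) (x \in ideal_pred I).
Proof. exact: asboolP. Qed.

Fact ideal_pred_submod : submod_closed (ideal_pred I).
Proof.
split=> [|a x y /ideal_predP Ix /ideal_predP Iy]; apply/ideal_predP.
  exact: ideal0.
exact: ideal_lin.
Qed.
HB.instance Definition _ :=
  GRing.isSubmodClosed.Build K L (ideal_pred I) ideal_pred_submod.

Definition subalg := {x : L | x \in ideal_pred I}.
HB.instance Definition _ := SubChoice.on subalg.
HB.instance Definition _ := [SubChoice_isSubLmodule of subalg by <:].

Lemma subalgP (x : subalg) : I (val x).
Proof. exact/ideal_predP/valP. Qed.

Definition to_subalg x (Ix : I x) : subalg :=
  Sub x (introT (ideal_predP x) Ix).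

Definition subalg_bracket (x y : subalg) : subalg :=
  to_subalg (ideal_bracketl (val y) (subalgP x)).

Fact subalg_bracket_linearr x : linear (subalg_bracket x).
Proof.
by move=> a y z; apply: val_inj; rewrite /= bracket_linearr.
Qed.
Fact subalg_bracket_linearl y : linear (subalg_bracket^~ y).
Proof.
by move=> a x z; apply: val_inj; rewrite /= bracket_linearl.
Qed.
Fact subalg_leibniz x y z : subalg_bracket x (subalg_bracket y z) =
  subalg_bracket (subalg_bracket x y) z - subalg_bracket (subalg_bracket x z) y.
Proof. by apply: val_inj; rewrite /= leibniz_identity. Qed.
HB.instance Definition _ := Lmodule_isLeibniz.Build K subalg
  subalg_bracket_linearr subalg_bracket_linearl subalg_leibniz.

Lemma val_bracket (x y : subalg) : val (bracket x y) = bracket (val x) (val y).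
Proof. by []. Qed.

End Subalgebra.

(** The additive group underlying [L / I] is the library's quotient of a
    [zmodType]; scaling and the bracket are those of representatives. *)
Section QuotientAlgebra.
Variables (K : fieldType) (L : leibnizType K) (I : ideal L).

Definition quotalg : Type := Quotient.quot (ideal_pred I).
HB.instance Definition _ := GRing.Zmodule.on quotalg.
HB.instance Definition _ := EqQuotient.on quotalg.

Definition qpi (x : L) : quotalg := \pi_(Quotient.quot (ideal_pred I)) x.

Lemma qpiP x y : qpi x = qpi y <-> I (x - y).
Proof.
by split=> [/eqP|/ideal_predP h]; [|apply/eqP]; rewrite -Quotient.idealrBE // => /ideal_predP.
Qed.
Lemma qpi_repr (x : quotalg) : qpi (repr x) = x.
Proof. exact: reprK. Qed.
Lemma qpi_surj (x : quotalg) : exists y, qpi y = x.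
Proof. by exists (repr x); exact: qpi_repr. Qed.
Lemma repr_qpi x : I (repr (qpi x) - x).
Proof. by apply/qpiP; exact: qpi_repr. Qed.

Lemma qpi_zmod : zmod_morphism qpi.
Proof. exact: (raddfB (\pi_(Quotient.quot (ideal_pred I)))). Qed.
HB.instance Definition _ := GRing.isZmodMorphism.Build L quotalg qpi qpi_zmod.

Definition quot_scale (a : K) (x : quotalg) : quotalg := qpi (a *: repr x).
Definition quot_bracket (x y : quotalg) : quotalg :=
  qpi (bracket (repr x) (repr y)).

Lemma quot_scale_qpi a x : quot_scale a (qpi x) = qpi (a *: x).
Proof. by apply/qpiP; rewrite -scalerBr; apply/idealZ/repr_qpi. Qed.

Lemma quot_bracket_qpi x y : quot_bracket (qpi x) (qpi y) = qpi (bracket x y).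
Proof.
apply/qpiP; set x' := repr _; set y' := repr _.
have -> : bracket x' y' - bracket x y =
    bracket (x' - x) y' + bracket x (y' - y).
  by rewrite bracketDl bracketDr bracketNl bracketNr addrA subrK.
apply: idealD; first exact/ideal_bracketl/repr_qpi.
exact/ideal_bracketr/repr_qpi.
Qed.

Fact quot_scaleA a b x : quot_scale a (quot_scale b x) = quot_scale (a * b) x.
Proof.
by have [y <-] := qpi_surj x; rewrite !quot_scale_qpi scalerA.
Qed.
Fact quot_scale1 : left_id 1 quot_scale.
Proof. by move=> x; have [y <-] := qpi_surj x; rewrite quot_scale_qpi scale1r. Qed.
Fact quot_scaleDr : right_distributive quot_scale +%R.
Proof.
move=> a x y; have [x' <-] := qpi_surj x; have [y' <-] := qpi_surj y.
by rewrite -raddfD !quot_scale_qpi scalerDr raddfD.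
Qed.
Fact quot_scaleDl x : {morph quot_scale^~ x : a b / a + b}.
Proof.
move=> a b; have [x' <-] := qpi_surj x.
by rewrite !quot_scale_qpi scalerDl raddfD.
Qed.
HB.instance Definition _ := GRing.Zmodule_isLmodule.Build K quotalg
  quot_scaleA quot_scale1 quot_scaleDr quot_scaleDl.

Lemma qpi_scalable : scalable qpi.
Proof. by move=> a x; rewrite -quot_scale_qpi. Qed.
HB.instance Definition _ :=
  GRing.isScalable.Build K L quotalg *:%R qpi qpi_scalable.

Fact quot_bracket_linearr x : linear (quot_bracket x).
Proof.
move=> a y z; have [x' <-] := qpi_surj x.
have [y' <-] := qpi_surj y; have [z' <-] := qpi_surj z.
by rewrite -linearP !quot_bracket_qpi bracket_linearr linearP.
Qed.
Fact quot_bracket_linearl y : linear (quot_bracket^~ y).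
Proof.
move=> a x z; have [x' <-] := qpi_surj x.
have [y' <-] := qpi_surj y; have [z' <-] := qpi_surj z.
by rewrite -linearP !quot_bracket_qpi bracket_linearl linearP.
Qed.
Fact quot_leibniz x y z : quot_bracket x (quot_bracket y z) =
  quot_bracket (quot_bracket x y) z - quot_bracket (quot_bracket x z) y.
Proof.
have [x' <-] := qpi_surj x.
have [y' <-] := qpi_surj y; have [z' <-] := qpi_surj z.
by rewrite !quot_bracket_qpi -linearB leibniz_identity.
Qed.
HB.instance Definition _ := Lmodule_isLeibniz.Build K quotalg
  quot_bracket_linearr quot_bracket_linearl quot_leibniz.

Lemma qpi_bracket : {morph qpi : x y / bracket x y}.
Proof. by move=> x y; rewrite -quot_bracket_qpi. Qed.
HB.instance Definition _ := isLeibnizMorphism.Build K L quotalg qpi qpi_bracket.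

End QuotientAlgebra.

Definition lie_capable (K : fieldType) (c : nat) (q : leibnizType K) : Prop :=
  exists h : leibnizType K, leibniz_isomorphic q (quotalg (lie_centre h c)).

(** A smallest ideal is unique as a set, so this predicate determines Z^*(q). *)
Definition is_lie_Zstar (K : fieldType) (c : nat) (q : leibnizType K)
    (s : ideal q) : Prop :=
  lie_capable c (quotalg s) /\
  forall t : ideal q, lie_capable c (quotalg t) -> s `<=` t.

Definition leibniz_free (K : fieldType) (f : leibnizType K) : Prop :=
  exists (X : Type) (i : X -> f), forall (L : leibnizType K) (g : X -> L),
    exists h : {leibniz f -> L}, (forall x, h (i x) = g x) /\
      forall h' : {leibniz f -> L}, (forall x, h' (i x) = g x) -> h' =1 h.

Section Subquotient.
Variables (K : fieldType) (L : leibnizType K).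

Section Restriction.
Variables I J : ideal L.
Fact restr_ideal0 : ((val : subalg J -> L) @^-1` I) 0.
Proof. exact: ideal0. Qed.
Fact restr_ideal_lin a x y : ((val : subalg J -> L) @^-1` I) x ->
  ((val : subalg J -> L) @^-1` I) y ->
  ((val : subalg J -> L) @^-1` I) (a *: x + y).
Proof. exact: ideal_lin. Qed.
Fact restr_ideal_bracketl x y : ((val : subalg J -> L) @^-1` I) x ->
  ((val : subalg J -> L) @^-1` I) (bracket x y).
Proof. exact: ideal_bracketl. Qed.
Fact restr_ideal_bracketr x y : ((val : subalg J -> L) @^-1` I) x ->
  ((val : subalg J -> L) @^-1` I) (bracket y x).
Proof. exact: ideal_bracketr. Qed.
Definition restr_ideal : ideal (subalg J) := Ideal restr_ideal0 restr_ideal_lin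
  restr_ideal_bracketl restr_ideal_bracketr.
End Restriction.

(** [J / I]; the uses below have [I] contained in [J] ([mult_den_sub_num]), but
    in general this is [J / (I cap J)]. *)
Definition subquot (J I : ideal L) : leibnizType K := quotalg (restr_ideal I J).

(** The map [J / I -> J' / I'] induced by inclusions of [J] in [J'] and of
    [I] in [I']. *)
Section Induced.
Variables (J I J' I' : ideal L) (sJ : J `<=` J') (sI : I `<=` I').

Definition incl (x : subalg J) : subalg J' := to_subalg (sJ (subalgP x)).

Definition induced_fun (x : subquot J I) : subquot J' I' :=
  qpi (restr_ideal I' J') (incl (repr x)).

Lemma induced_fun_qpi x :
  induced_fun (qpi (restr_ideal I J) x) = qpi (restr_ideal I' J') (incl x).
Proof.
apply/qpiP; rewrite /= /preimage /=; apply: sI.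
exact: (repr_qpi (restr_ideal I J) x).
Qed.

Fact induced_linear : linear induced_fun.
Proof.
move=> a x y; have [x' <-] := qpi_surj x; have [y' <-] := qpi_surj y.
rewrite -linearP !induced_fun_qpi -linearP; congr qpi.
exact: val_inj.
Qed.
Fact induced_bracket : {morph induced_fun : x y / bracket x y}.
Proof.
move=> x y; have [x' <-] := qpi_surj x; have [y' <-] := qpi_surj y.
rewrite -bracket_morph !induced_fun_qpi -bracket_morph; congr qpi.
exact: val_inj.
Qed.

Definition induced : {leibniz subquot J I -> subquot J' I'} :=
  HB.pack induced_fun
    (GRing.isLinear.Build K (subquot J I) (subquot J' I') *:%R induced_fun
       induced_linear)
    (isLeibnizMorphism.Build K (subquot J I) (subquot J' I') induced_fun
       induced_bracket).

Lemma induced_qpi x :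
  induced (qpi (restr_ideal I J) x) = qpi (restr_ideal I' J') (incl x).
Proof. exact: induced_fun_qpi. Qed.

(** As [J] is an ideal of [L], the image is an ideal of [J' / I']. *)
Fact induced_im0 : range induced 0.
Proof. by exists 0 => //; exact: raddf0. Qed.
Fact induced_im_lin a x y :
  range induced x -> range induced y -> range induced (a *: x + y).
Proof. by move=> [u _ <-] [v _ <-]; exists (a *: u + v); rewrite ?linearP. Qed.
Fact induced_im_bracketl x y : range induced x -> range induced (bracket x y).
Proof.
move=> [u _ <-]; have [u' <-] := qpi_surj u; have [y' <-] := qpi_surj y.
exists (qpi _ (to_subalg (ideal_bracketl (val y') (subalgP u')))) => //.
by rewrite !induced_qpi -bracket_morph; congr qpi; exact: val_inj.
Qed.
Fact induced_im_bracketr x y : range induced x -> range induced (bracket y x).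
Proof.
move=> [u _ <-]; have [u' <-] := qpi_surj u; have [y' <-] := qpi_surj y.
exists (qpi _ (to_subalg (ideal_bracketr (val y') (subalgP u')))) => //.
by rewrite !induced_qpi -bracket_morph; congr qpi; exact: val_inj.
Qed.
Definition induced_im : ideal (subquot J' I') := Ideal induced_im0
  induced_im_lin induced_im_bracketl induced_im_bracketr.

End Induced.
End Subquotient.

Section Multiplier.
Variables (K : fieldType) (c : nat) (f : leibnizType K).

(** The multiplier of [f / r], for [f] free: numerator and denominator of
    (r cap gamma_(c+1)(f)) / gamma_(c+1)(f, r). *)
Definition mult_num (r : ideal f) : ideal f :=
  cap_ideal r (gamma_lie c.+1 full_ideal).
Definition mult_den (r : ideal f) : ideal f := gamma_lie c.+1 r.
Definition lie_multiplier (r : ideal f) : leibnizType K :=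
  subquot (mult_num r) (mult_den r).

Lemma mult_num_sub (r s : ideal f) : r `<=` s -> mult_num r `<=` mult_num s.
Proof. by move=> rs x [rx gx]; split=> //; exact: rs. Qed.

Lemma mult_den_sub_num (r : ideal f) : mult_den r `<=` mult_num r.
Proof.
move=> x rx; split; last by apply: gamma_lie_sub rx.
have gamma_sub k : iter k (fun m => lie_comm m full_ideal) r `<=` r.
  elim: k => //= k IHk y; apply: lspan_min; first exact: ideal0.
    exact: ideal_lin.
  move=> _ [u [v [/IHk ru _ ->]]].
  by apply: idealD; [exact: ideal_bracketl|exact: ideal_bracketr].
exact: gamma_sub rx.
Qed.

Variables (q : leibnizType K) (rho : {leibniz f -> q}) (n : ideal q).

Lemma ker_sub_preim : ker_ideal rho `<=` preim_ideal rho n.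
Proof. by move=> x; rewrite /= /preimage /= => ->; exact: ideal0. Qed.

(** The natural map M(q) -> M(q / n) and its image, for the presentations
    [rho] of [q] and [f -> q / n] of [q / n]. *)
Definition mult_nat :
    {leibniz lie_multiplier (ker_ideal rho) ->
             lie_multiplier (preim_ideal rho n)} :=
  induced (mult_num_sub ker_sub_preim) (gamma_lie_sub (i := c.+1) ker_sub_preim).
Definition mult_nat_im : ideal (lie_multiplier (preim_ideal rho n)) :=
  induced_im (mult_num_sub ker_sub_preim)
    (gamma_lie_sub (i := c.+1) ker_sub_preim).

(** M(q) embeds in M(q / n) by the natural map, and [rho] induces an
    isomorphism from the quotient onto n cap gamma_(c+1)(q): the class of [x]
    is sent to [rho x]. *)
Definition mult_quotient_iso : Prop :=
  injective mult_nat /\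
  exists phi : {leibniz quotalg mult_nat_im ->
                        subalg (cap_ideal n (gamma_lie c.+1 full_ideal))},
    bijective phi /\
    forall x : subalg (mult_num (preim_ideal rho n)),
      val (phi (qpi mult_nat_im
                 (qpi (restr_ideal (mult_den (preim_ideal rho n)) _) x)))
      = rho (val x).

End Multiplier.

(* Main.v *)
(** Write [r = ker rho], [s] for the preimage of [n] and [x o y] for
    [[x, y] + [y, x]]. As [n] is c-Lie-central, gamma_(c+1)(f, s) lies in [r],
    so (a) and (c) both say that gamma_(c+1)(f, s) = gamma_(c+1)(f, r), i.e.
    that [n] lies in [rho P], where [P] is the preimage in [f] of the c-th
    Lie-centre of f / gamma_(c+1)(f, r). The quotient of [q] by [rho P] is
    c-Lie-capable, so it remains to see that [rho P] lies in every [t] with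
    [q / t] isomorphic to h / Z_c(h). Lift [rho] to [phi : f -> h].
    Then [h = phi f + Z_c(h)], but elements of [Z_c(h)] need not annihilate
    iterated Lie-commutators from [h], so for c > 1 the mere fact that the
    c-fold Lie-commutators of [x] in [P] lie in gamma_(c+1)(f, r) does not give
    that [phi x] is in [Z_c(h)]. Freeness of [f] repairs this: on
    [right_ann f], which contains all Lie-commutators, [a o f] inside [J o f]
    implies that [a] is in [J], whence [x o f] lies in [r o f] for [x] in [P].
    Then [phi x o phi f] and [phi x o Z_c(h)] both lie in [Z_(c-1)(h)]. *)

Require Import Defs.
From HB Require Import structures.
From mathcomp Require Import all_boot all_order all_algebra.
From mathcomp Require Import boolp classical_sets functions.

Set Implicit Arguments.
Unset Strict Implicit.
Unset Printing Implicit Defensive.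

Import GRing.Theory.
Local Open Scope ring_scope.
Local Open Scope classical_set_scope.

(** * Morphisms of Leibniz algebras *)

Section Morphisms.
Variables (K : fieldType) (L M N : leibnizType K).

Fact leibniz_id_bracket : {morph (idfun : L -> L) : x y / bracket x y}.
Proof. by []. Qed.
HB.instance Definition _ :=
  isLeibnizMorphism.Build K L L idfun leibniz_id_bracket.

Fact leibniz_comp_bracket (g : {leibniz M -> N}) (h : {leibniz L -> M}) :
  {morph (g \o h) : x y / bracket x y}.
Proof. by move=> x y; rewrite /= !bracket_morph. Qed.
HB.instance Definition _ (g : {leibniz M -> N}) (h : {leibniz L -> M}) :=
  isLeibnizMorphism.Build K L N (g \o h) (leibniz_comp_bracket g h).

Lemma leibniz_free_ext X (i : X -> L)
  (iP : forall (L' : leibnizType K) (g : X -> L'),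
    exists h : {leibniz L -> L'}, (forall x, h (i x) = g x) /\
      forall h' : {leibniz L -> L'}, (forall x, h' (i x) = g x) -> h' =1 h)
  (g h : {leibniz L -> M}) : (forall x, g (i x) = h (i x)) -> g =1 h.
Proof.
by have [k [_ k_uniq]] := iP M (h \o i) => gh y; rewrite !k_uniq.
Qed.
End Morphisms.

Section Zero.
Variables (K : fieldType) (L M : leibnizType K).
Definition leibniz_zero_fun (x : L) : M := 0.
Fact leibniz_zero_linear : linear leibniz_zero_fun.
Proof. by move=> a x y; rewrite scaler0 addr0. Qed.
Fact leibniz_zero_bracket : {morph leibniz_zero_fun : x y / bracket x y}.
Proof. by move=> x y; rewrite bracket0l. Qed.
HB.instance Definition _ :=
  GRing.isLinear.Build K L M *:%R leibniz_zero_fun leibniz_zero_linear.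
HB.instance Definition _ :=
  isLeibnizMorphism.Build K L M leibniz_zero_fun leibniz_zero_bracket.
End Zero.

Lemma leibniz_morphB (K : fieldType) (L M : leibnizType K)
  (h : {leibniz L -> M}) : {morph h : x y / x - y}.
Proof. exact: raddfB. Qed.

Lemma lie_sym_morph (K : fieldType) (L M : leibnizType K)
  (h : {leibniz L -> M}) : {morph h : x y / lie_sym x y}.
Proof.
by move=> x y; rewrite /lie_sym raddfD; congr (_ + _); exact: bracket_morph.
Qed.

Lemma qpi_eq0 (K : fieldType) (L : leibnizType K) (I : ideal L) x :
  qpi I x = 0 <-> I x.
Proof. by rewrite -(raddf0 (qpi I)) qpiP subr0. Qed.

(** * Stripping the last letter, and cancellation in free Leibniz algebras *)

Section StripAlgebra.
Variables (K : fieldType) (L : leibnizType K) (J : ideal L).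

(** Preservation of [J] is built in so that stripping [[j, u]] with [j] in [J] stays in [J] for
    every [u]. *)
Definition stable_op_pred : {pred L -> L} :=
  fun A => `[< linear A /\ forall x, J x -> J (A x) >].

Fact stable_op_submod : submod_closed stable_op_pred.
Proof.
split=> [|a A B /asboolP[Alin AJ] /asboolP[Blin BJ]]; apply/asboolP; split.
- by move=> b x y; rewrite /= scaler0 addr0.
- by move=> x _; exact: ideal0.
- move=> b x y; rewrite !fctE Alin Blin !scalerDr !scalerA mulrC.
  by rewrite addrACA.
- by move=> x Jx; apply: ideal_lin; [exact: AJ|exact: BJ].
Qed.
HB.instance Definition _ :=
  GRing.isSubmodClosed.Build K (L -> L) stable_op_pred stable_op_submod.

Definition stable_op := {A : L -> L | A \in stable_op_pred}.
HB.instance Definition _ := SubChoice.on stable_op.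
HB.instance Definition _ := [SubChoice_isSubLmodule of stable_op by <:].

Lemma stable_op_linear (A : stable_op) : linear (val A).
Proof. by have /asboolP[] := valP A. Qed.
Lemma stable_op_ideal (A : stable_op) x : J x -> J (val A x).
Proof. by have /asboolP[_] := valP A; exact. Qed.
Lemma stable_opD (A : stable_op) x y : val A (x + y) = val A x + val A y.
Proof. by have := stable_op_linear A 1 x y; rewrite !scale1r. Qed.
Lemma stable_opN (A : stable_op) x : val A (- x) = - val A x.
Proof.
have A0 : val A 0 = 0.
  by apply: (addIr (val A 0)); rewrite -stable_opD !add0r.
by have := stable_op_linear A (-1) x 0; rewrite A0 !addr0 !scaleN1r.
Qed.

Fact stable_op_id_subproof : (id : L -> L) \in stable_op_pred.
Proof. by apply/asboolP. Qed.
Definition stable_op_id : stable_op := Sub (id : L -> L) stable_op_id_subproof.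

Fact op_cocycle_subproof (A B : stable_op) (x y : L) :
  (fun w => val B (bracket w x) - val A (bracket w y)) \in stable_op_pred.
Proof.
apply/asboolP; split=> [a u v|u Ju] /=.
  by rewrite !bracket_linearl !stable_op_linear scalerBr opprD addrACA.
by apply: idealB; apply/stable_op_ideal/ideal_bracketl.
Qed.
(** Forced by the Leibniz identity: stripping [[w, [x, y]] = [[w, x], y] - [[w, y], x]] applies [B]
    to [[w, x]] and [A] to [[w, y]]. *)
Definition op_cocycle A B x y : stable_op :=
  Sub (fun w => val B (bracket w x) - val A (bracket w y))
    (op_cocycle_subproof A B x y).

(** A morphism [h : L -> strip_alg] lifting the identity has
    [(h [w, u]).2 = val (h u).1.2 w]. For [L] free, seen as a free right module
    over a tensor algebra, prescribing [id] on a generator [x0] and [0] on the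
    other ones makes [(h w).2] the result of stripping the last letter [x0]
    from [w]. *)
Definition strip_alg : Type := (L * stable_op * L)%type.
HB.instance Definition _ := GRing.Lmodule.on strip_alg.

Definition strip_bracket (x y : strip_alg) : strip_alg :=
  (bracket x.1.1 y.1.1, op_cocycle x.1.2 y.1.2 x.1.1 y.1.1, val y.1.2 x.1.1).

Fact strip_bracket_linearr x : linear (strip_bracket x).
Proof.
move=> a y z; congr (_, _, _) => /=; first exact: bracket_linearr.
apply/val_inj/funext=> w; rewrite /= !fctE bracket_linearr stable_op_linear.
by rewrite scalerBr opprD addrACA.
Qed.
Fact strip_bracket_linearl y : linear (strip_bracket^~ y).
Proof.
move=> a x z; congr (_, _, _) => /=; first exact: bracket_linearl.
  apply/val_inj/funext=> w; rewrite /= !fctE bracket_linearr stable_op_linear.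
  by rewrite scalerBr opprD addrACA.
exact: stable_op_linear.
Qed.
Fact strip_leibniz x y z : strip_bracket x (strip_bracket y z) =
  strip_bracket (strip_bracket x y) z - strip_bracket (strip_bracket x z) y.
Proof.
case: x y z => [[x A] d] [[y B] e] [[z C] g].
congr (_, _, _) => /=; first exact: leibniz_identity.
apply/val_inj/funext=> w; rewrite /= !fctE /= !leibniz_identity.
rewrite !stable_opD !stable_opN !opprB.
rewrite [RHS]addrACA !subrKA addrACA [RHS]addrACA.
by congr (_ + _); rewrite addrC.
Qed.
HB.instance Definition _ := Lmodule_isLeibniz.Build K strip_alg
  strip_bracket_linearr strip_bracket_linearl strip_leibniz.

Definition strip_proj (x : strip_alg) : L := x.1.1.
Fact strip_proj_linear : linear strip_proj. Proof. by []. Qed.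
Fact strip_proj_bracket : {morph strip_proj : x y / bracket x y}.
Proof. by []. Qed.
HB.instance Definition _ :=
  GRing.isLinear.Build K strip_alg L *:%R strip_proj strip_proj_linear.
HB.instance Definition _ :=
  isLeibnizMorphism.Build K strip_alg L strip_proj strip_proj_bracket.
End StripAlgebra.

Definition right_ann (K : fieldType) (L : leibnizType K) : set L :=
  [set a | forall u, bracket u a = 0].
Arguments right_ann {K} L.

(** For [a] in [right_ann f] the Lie-commutator with a generator [x0] is just [[a, x0]], and
    stripping [x0] returns [a]. Likewise [J o f] is spanned by the [[j, u]], which strip into
    [J]. *)
Lemma free_lie_centre_mod (K : fieldType) (f : leibnizType K) (J : ideal f) :
  leibniz_free f -> J `<=` right_ann f ->
  lie_centre_mod (lie_comm J full_ideal) `&` right_ann f `<=` J.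
Proof.
move=> [X [i iP]] Jann a [aJ aann].
(* Without generators the identity and the zero morphism agree, so [f = 0]. *)
have [[x0]|noX] := pselect (inhabited X); last first.
  have -> : a = 0; last exact: ideal0.
  apply: (leibniz_free_ext iP (g := idfun) (h := @leibniz_zero_fun K f f)) => x.
  by case: noX.
pose g x : strip_alg J :=
  (i x, if pselect (x = x0) then stable_op_id J else 0, 0).
have [h [hi _]] := iP _ g.
have h1 u : (h u).1.1 = u.
  apply: (leibniz_free_ext iP (g := @strip_proj K f J \o h) (h := idfun)) => x.
  by rewrite /= hi.
have h3 w u : (h (bracket w u)).2 = val (h u).1.2 w.
  by rewrite bracket_morph /= h1.
have : J (h (lie_sym a (i x0))).2.
  move: (aJ (i x0)).
  apply: (lspan_min (B := fun z => J (h z).2))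
    => [|b x y Jx Jy|_ [j [u [Jj _ ->]]]].
  - by rewrite raddf0; exact: ideal0.
  - by rewrite linearP; exact: ideal_lin.
  - by rewrite /lie_sym (Jann _ Jj) addr0 h3; exact: stable_op_ideal.
by rewrite /lie_sym aann addr0 h3 hi /g /=; case: pselect.
Qed.

(** * Lower Lie-central series against iterated Lie-centres *)

Section LieSeries.
Variables (K : fieldType) (L : leibnizType K).
Implicit Types I J : ideal L.

Lemma lie_comm_subP I J :
  lie_comm I full_ideal `<=` J <-> I `<=` lie_centre_mod J.
Proof.
split=> [IJ x Ix h|IJ x].
  by apply/IJ/sub_lspan; exists x, h.
apply: lspan_min; [exact: ideal0|exact: ideal_lin|].
by move=> _ [u [v [Iu _ ->]]]; exact: IJ.
Qed.

(** Iterates the Galois connection [lie_comm_subP]; the outermost commutator becomes the innermost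
    centre, hence [iterSr]. *)
Lemma gamma_lie_subP k I J :
  gamma_lie k.+1 I `<=` J <-> I `<=` iter k (@lie_centre_mod K L) J.
Proof.
elim: k J => // k IHk J.
by rewrite iterSr -IHk -lie_comm_subP.
Qed.

Lemma gamma_lie_right_ann k I : gamma_lie k.+2 I `<=` right_ann L.
Proof.
move=> x; apply: lspan_min => [u|a y z y0 z0 u|_ [y [z [_ _ ->]]] u].
- exact: bracket0r.
- by rewrite bracket_linearr y0 z0 scaler0 addr0.
- exact: bracket_sym0.
Qed.

(** Each layer replaces [x] by some [lie_sym x h], which is again in [right_ann L]. *)
Lemma iter_lie_centre_mod_ann k I J : I `&` right_ann L `<=` J ->
  iter k (@lie_centre_mod K L) I `&` right_ann L `<=`
  iter k (@lie_centre_mod K L) J.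
Proof.
move=> IJ; elim: k => // k IHk x [xI xann]; rewrite iterS => h.
apply: (IHk (lie_sym x h)).
split; first exact: xI.
by move=> u; exact: bracket_sym0.
Qed.

Lemma iter_lie_centre_mod_free k I : leibniz_free L ->
  iter k.+1 (@lie_centre_mod K L) (gamma_lie k.+2 I) `<=`
  lie_centre_mod (lie_comm I full_ideal).
Proof.
move=> L_free x xk h.
(* One layer is spent on passing from [x], which need not be in [right_ann L], to [lie_sym x h],
   which is. *)
have {xk} : (iter k (@lie_centre_mod K L) (gamma_lie k.+2 I) `&`
    right_ann L) (lie_sym x h).
  by split=> [|u]; [exact: xk|exact: bracket_sym0].
elim: k (lie_sym x h) => [y []//|k IHk] y [yk yann].
(* Freeness cancels the innermost layer: on [right_ann L], [lie_centre_mod (gamma_lie k.+3 I)] lies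
   in [gamma_lie k.+2 I]. *)
apply: IHk; split=> //; apply: iter_lie_centre_mod_ann (conj _ yann).
  apply: (@free_lie_centre_mod K L) => //.
  exact: gamma_lie_right_ann.
by rewrite iterSr in yk.
Qed.

Lemma iter_lie_centre_surj (M : leibnizType K) (h : {leibniz L -> M}) k I
    (J : ideal M) :
  (forall y, exists x, h x = y) -> (forall x, J (h x) <-> I x) ->
  forall x, iter k (@lie_centre_mod K M) J (h x) <->
            iter k (@lie_centre_mod K L) I x.
Proof.
move=> h_surj IJ; elim: k => // k IHk x; rewrite !iterS; split=> xP y.
  by apply/IHk; rewrite lie_sym_morph; exact: xP.
by have [{}y <-] := h_surj y; rewrite -lie_sym_morph; apply/IHk/xP.
Qed.
End LieSeries.

(** * Images under surjections and factorisation of morphisms *)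

Section Image.
Variables (K : fieldType) (L M : leibnizType K) (h : {leibniz L -> M}).
Hypothesis h_surj : forall y, exists x, h x = y.
Variable I : ideal L.
Fact image_ideal0 : (h @` I) 0.
Proof. by exists 0; [exact: ideal0|exact: raddf0]. Qed.
Fact image_ideal_lin a x y : (h @` I) x -> (h @` I) y -> (h @` I) (a *: x + y).
Proof.
move=> [u Iu <-] [v Iv <-]; exists (a *: u + v); last exact: linearP.
exact: ideal_lin.
Qed.
Fact image_ideal_bracketl x y : (h @` I) x -> (h @` I) (bracket x y).
Proof.
move=> [u Iu <-]; have [v <-] := h_surj y.
by exists (bracket u v); [exact: ideal_bracketl|exact: bracket_morph].
Qed.
Fact image_ideal_bracketr x y : (h @` I) x -> (h @` I) (bracket y x).
Proof.
move=> [u Iu <-]; have [v <-] := h_surj y.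
by exists (bracket v u); [exact: ideal_bracketr|exact: bracket_morph].
Qed.
Definition image_ideal : ideal M := Ideal image_ideal0 image_ideal_lin
  image_ideal_bracketl image_ideal_bracketr.
End Image.

Section GammaMorphism.
Variables (K : fieldType) (L M : leibnizType K) (h : {leibniz L -> M}).

Lemma gamma_lie_morph i (I : ideal L) (J : ideal M) :
  I `<=` h @^-1` J -> gamma_lie i I `<=` h @^-1` gamma_lie i J.
Proof.
move=> IJ; rewrite /gamma_lie; elim: i.-1 => // k IHk x.
apply: (@lspan_min _ _ _ (preim_ideal h (lie_comm _ _))).
- exact: ideal0.
- exact: ideal_lin.
move=> _ [u [v [/IHk Ju _ ->]]]; apply: sub_lspan.
by exists (h u), (h v); split=> //; exact: lie_sym_morph.
Qed.

Lemma gamma_lie_image i (I : ideal L) (J : ideal M) :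
  (forall y, exists x, h x = y) ->
  J `<=` h @` I -> gamma_lie i J `<=` h @` gamma_lie i I.
Proof.
move=> h_surj IJ; rewrite /gamma_lie; elim: i.-1 => // k IHk x.
apply: (@lspan_min _ _ _ (image_ideal h_surj (lie_comm _ _))).
- exact: ideal0.
- exact: ideal_lin.
move=> _ [_ [w [/IHk[u Iu <-] _ ->]]]; have [v <-] := h_surj w.
exists (lie_sym u v); first by apply: sub_lspan; exists u, v.
exact: lie_sym_morph.
Qed.
End GammaMorphism.

Section Factor.
Variables (K : fieldType) (L M N : leibnizType K).
Variables (h : {leibniz L -> M}) (g : {leibniz L -> N}).
Hypothesis h_surj : forall y, exists x, h x = y.

Lemma leibniz_factor : (forall x, h x = 0 -> g x = 0) ->
  exists phi : {leibniz M -> N}, forall x, phi (h x) = g x.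
Proof.
move=> hg; have /choice[sec secP] := h_surj.
have gE x y : h x = h y -> g x = g y.
  move=> hxy; apply/eqP; rewrite -subr_eq0 -leibniz_morphB; apply/eqP/hg.
  by rewrite leibniz_morphB hxy subrr.
pose phi := g \o sec.
have phiE x : phi (h x) = g x by apply/gE/secP.
have phi_lin : linear phi.
  by move=> a x y; rewrite -(secP x) -(secP y) -linearP !phiE linearP.
have phi_brk : {morph phi : x y / bracket x y}.
  by move=> x y; rewrite -(secP x) -(secP y) -bracket_morph !phiE bracket_morph.
pose phi' : {leibniz M -> N} := HB.pack phi
  (GRing.isLinear.Build K M N *:%R phi phi_lin)
  (isLeibnizMorphism.Build K M N phi phi_brk).
by exists phi'.
Qed.
End Factor.

Lemma leibniz_factor_iso (K : fieldType) (L M N : leibnizType K)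
    (h : {leibniz L -> M}) (g : {leibniz L -> N}) :
  (forall y, exists x, h x = y) -> (forall y, exists x, g x = y) ->
  (forall x, h x = 0 <-> g x = 0) ->
  exists phi : {leibniz M -> N}, bijective phi /\ forall x, phi (h x) = g x.
Proof.
move=> h_surj g_surj hg.
have [phi phiE] := leibniz_factor h_surj (fun x => proj1 (hg x)).
have [psi psiE] := leibniz_factor g_surj (fun x => proj2 (hg x)).
exists phi; split=> //; exists psi => y.
  by have [x <-] := h_surj y; rewrite phiE.
by have [x <-] := g_surj y; rewrite psiE.
Qed.

(** * The candidate for Z^*: capability of the quotient and minimality *)

Section Capability.
Variables (K : fieldType) (c : nat) (f q : leibnizType K).
Variable rho : {leibniz f -> q}.
Hypothesis rho_surj : forall y, exists x, rho x = y.

Definition pre_Zstar : ideal f :=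
  iter c (@lie_centre_mod K f) (gamma_lie c.+1 (ker_ideal rho)).

(** By adjunction this is the inclusion of gamma_(c+1)(f, r) in itself. *)
Lemma ker_sub_pre_Zstar : ker_ideal rho `<=` pre_Zstar.
Proof. by apply/gamma_lie_subP. Qed.

Definition free_Zstar : ideal q := image_ideal rho_surj pre_Zstar.

Lemma free_ZstarP x : free_Zstar (rho x) <-> pre_Zstar x.
Proof.
split=> [[y Py /eqP]|Px]; last by exists x.
rewrite -subr_eq0 -leibniz_morphB => /eqP rxy.
by rewrite -(subKr y x); apply: idealB => //; exact: ker_sub_pre_Zstar.
Qed.

(** With h = f / gamma_(c+1)(f, r), both q / rho P and h / Z_c(h) are quotients of [f] with kernel
    [pre_Zstar]. *)
Lemma free_Zstar_capable : lie_capable c (quotalg free_Zstar).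
Proof.
exists (quotalg (gamma_lie c.+1 (ker_ideal rho))).
set G := gamma_lie _ _; set Z := lie_centre _ c.
have [||x|phi [phi_bij _]] := @leibniz_factor_iso K f _ _
  (qpi free_Zstar \o rho) (qpi Z \o qpi G); last by exists phi.
- by move=> y; have [x <-] := qpi_surj y; have [w <-] := rho_surj x; exists w.
- by move=> y; have [x <-] := qpi_surj y; have [w <-] := qpi_surj x; exists w.
rewrite /= !qpi_eq0 free_ZstarP.
apply: iff_sym; apply: iter_lie_centre_surj => [y|y]; first exact: qpi_surj.
exact: qpi_eq0.
Qed.
End Capability.

Lemma free_Zstar_min (K : fieldType) (k : nat) (f q : leibnizType K)
    (rho : {leibniz f -> q}) (rho_surj : forall y, exists x, rho x = y)
    (t : ideal q) : leibniz_free f -> lie_capable k.+1 (quotalg t) ->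
  free_Zstar k.+1 rho_surj `<=` t.
Proof.
move=> f_free [h [alpha alpha_bij]] _ [x Px <-].
have [X [i iP]] := f_free.
set Z := lie_centre h k.+1 in alpha alpha_bij.
have /choice[lift liftP] := qpi_surj (I := Z).
have [phi [phi_i _]] := iP h (fun u => lift (alpha (qpi t (rho (i u))))).
have phiE u : qpi Z (phi u) = alpha (qpi t (rho u)).
  apply: (leibniz_free_ext iP (g := qpi Z \o phi)
    (h := alpha \o (qpi t \o rho))) => v.
  by rewrite /= phi_i liftP.
have phi_ker : ker_ideal rho `<=` preim_ideal phi Z.
  by move=> u ru; apply/(@qpi_eq0 K h Z); rewrite phiE ru !raddf0.
suff: Z (phi x).
  move/qpi_eq0; rewrite phiE -(raddf0 alpha) => /(bij_inj alpha_bij).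
  by move/qpi_eq0.
have xG := iter_lie_centre_mod_free f_free Px.
have phi_comm : lie_comm (ker_ideal rho) full_ideal `<=`
    preim_ideal phi (lie_centre h k).
  apply/lie_comm_subP => u /phi_ker uZ v.
  by rewrite /= /preimage lie_sym_morph; exact: uZ.
move=> w; have [beta alphaK betaK] := alpha_bij.
(* Surjectivity of [alpha] and [rho] yields [y] with [phi y] congruent to [w] modulo [Z], whence h =
   phi f + Z_c(h). *)
have [p tp] := qpi_surj (beta (qpi Z w)); have [y ry] := rho_surj p.
have wZ : Z (w - phi y).
  by apply/qpiP; rewrite phiE ry tp betaK.
have -> : lie_sym (phi x) w = lie_sym (w - phi y) (phi x) + phi (lie_sym x y).
  rewrite lie_sym_morph [lie_sym (phi x) (phi y)]addrC -lie_symDl subrK.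
  by rewrite /lie_sym addrC.
apply: idealD; first exact: wZ.
exact/phi_comm/xG.
Qed.

(** * The natural map of multipliers: kernel, image and cokernel *)

Section NaturalMap.
Variables (K : fieldType) (c : nat) (f q : leibnizType K).
Variables (rho : {leibniz f -> q}) (n : ideal q).
Local Notation r := (ker_ideal rho).
Local Notation s := (preim_ideal rho n).

(** The kernel is (gamma_(c+1)(f, s) cap r) / gamma_(c+1)(f, r): lying in gamma_(c+1)(f) is
    automatic by [mult_den_sub_num]. *)
Lemma mult_nat_injP :
  injective (mult_nat c rho n) <-> mult_den c s `&` r `<=` mult_den c r.
Proof.
split=> [inj x [sx rx]|sr a b].
  have nx : mult_num c r x by split=> //; have [] := mult_den_sub_num sx.
  have := inj (qpi (restr_ideal (mult_den c r) _) (to_subalg nx)) 0.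
  rewrite raddf0 [mult_nat _ _ _ _]induced_qpi !qpi_eq0; exact.
have [u <-] := qpi_surj a; have [v <-] := qpi_surj b.
rewrite ![mult_nat _ _ _ _]induced_qpi => /qpiP uv.
apply/qpiP/sr; split; first exact: uv.
by have [] := subalgP (u - v).
Qed.

Hypothesis rho_surj : forall y, exists x, rho x = y.
Hypothesis n_central : lie_central c n.

Lemma mult_den_sub_ker : mult_den c s `<=` r.
Proof.
move=> x /(@gamma_lie_morph _ _ _ rho c.+1 s n (fun _ => id)).
by rewrite n_central.
Qed.

Lemma sub_free_ZstarP :
  n `<=` free_Zstar c rho_surj <-> injective (mult_nat c rho n).
Proof.
rewrite mult_nat_injP; have -> : mult_den c s `&` r = mult_den c s.
  exact/setIidPl/mult_den_sub_ker.
rewrite gamma_lie_subP; split=> [nZ x sx|sP y ny].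
  by apply/(free_ZstarP c rho_surj)/nZ.
have [x rx] := rho_surj y; rewrite -rx; apply/free_ZstarP/sP.
by rewrite /= /preimage /= rx.
Qed.

(** By centrality [rho] kills the denominator gamma_(c+1)(f, s), so it can be evaluated on
    representatives. *)
Lemma mult_nat_imP (x : subalg (mult_num c s)) :
  mult_nat_im c rho n (qpi _ x) <-> rho (val x) = 0.
Proof.
split=> [[a _]|rx].
  have [u <-] := qpi_surj a; rewrite induced_qpi => /qpiP ux.
  have ru : r (val u) by have [] := subalgP u.
  have rd := mult_den_sub_ker ux.
  have -> : val x = val u - (val u - val x) by rewrite subKr.
  by rewrite leibniz_morphB ru rd subrr.
have nx : mult_num c r (val x) by split=> //; have [] := subalgP x.
exists (qpi _ (to_subalg nx)) => //; rewrite induced_qpi; congr qpi.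
exact: val_inj.
Qed.

Fact num_morph_subproof (x : subalg (mult_num c s)) :
  cap_ideal n (gamma_lie c.+1 full_ideal) (rho (val x)).
Proof.
have [nx gx] := subalgP x; split=> //.
exact: (@gamma_lie_morph _ _ _ rho c.+1 full_ideal full_ideal (fun _ => id)).
Qed.
Definition num_morph x : subalg (cap_ideal n (gamma_lie c.+1 full_ideal)) :=
  to_subalg (num_morph_subproof x).
Fact num_morph_linear : linear num_morph.
Proof. by move=> a x y; apply: val_inj; rewrite /= linearP. Qed.
Fact num_morph_bracket : {morph num_morph : x y / bracket x y}.
Proof. by move=> x y; apply: val_inj; rewrite /= bracket_morph. Qed.
HB.instance Definition _ := GRing.isLinear.Build K _ _ *:%R num_morph
  num_morph_linear.
HB.instance Definition _ := isLeibnizMorphism.Build K _ _ num_morph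
  num_morph_bracket.

(** The isomorphism in (a) is the first isomorphism theorem for [num_morph], so (a) amounts to its
    embedding clause. *)
Lemma mult_quotient_isoP :
  mult_quotient_iso c rho n <-> injective (mult_nat c rho n).
Proof.
split=> [[]//|inj]; split=> //.
have [||x|phi [phi_bij phiE]] := @leibniz_factor_iso K _ _ _
  (qpi (mult_nat_im c rho n) \o qpi (restr_ideal (mult_den c s) (mult_num c s)))
  num_morph.
- by move=> y; have [x <-] := qpi_surj y; have [w <-] := qpi_surj x; exists w.
- move=> y; have [ny gy] := subalgP y.
  (* A preimage taken inside gamma_(c+1)(f) is automatically in [s], since its image lies in [n]. *)
  have [x gx rx] : (rho @` gamma_lie c.+1 full_ideal) (val y).
    apply: (gamma_lie_image rho_surj) gy => z _.
    by have [w <-] := rho_surj z; exists w.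
  have nx : mult_num c s x by split=> //; rewrite /= /preimage /= rx.
  by exists (to_subalg nx); apply: val_inj.
- rewrite /= qpi_eq0 mult_nat_imP; split=> [rx|/(congr1 val)//].
  exact: val_inj.
by exists phi; split=> // x; rewrite -[RHS]/(val (num_morph x)) -phiE.
Qed.

End NaturalMap.

Theorem theorem6p8 (K : fieldType) (half : (2%:R : K) != 0)
    (c : nat) (c_ge1 : (1 <= c)%N)
    (q : leibnizType K) (n : ideal q) (n_central : lie_central c n)
    (f : leibnizType K) (f_free : leibniz_free f)
    (rho : {leibniz f -> q}) (rho_surj : forall y, exists x, rho x = y) :
  (mult_quotient_iso c rho n <->
     exists2 Zstar : ideal q, is_lie_Zstar c Zstar & n `<=` Zstar) /\
  ((exists2 Zstar : ideal q, is_lie_Zstar c Zstar & n `<=` Zstar) <->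
     injective (mult_nat c rho n)).
Proof.
rewrite mult_quotient_isoP // -(sub_free_ZstarP rho_surj n_central).
(* It remains to see that [free_Zstar] is Z^*; [c_ge1] enters by writing [c] as [k.+1] for
   [free_Zstar_min]. *)
have -> : (exists2 Zstar : ideal q, is_lie_Zstar c Zstar & n `<=` Zstar) <->
    n `<=` free_Zstar c rho_surj; last by [].
have capable := free_Zstar_capable c rho_surj.
split=> [[Z [_ Zmin] nZ]|nZ]; first exact: subset_trans nZ (Zmin _ capable).
exists (free_Zstar c rho_surj) => //; split=> // t t_capable.
case: c c_ge1 t_capable {n_central nZ capable} => // k _.
exact: free_Zstar_min.
Qed.
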